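(* Let $(\mathfrak g_0,B_0,(\rho,V))$ be a fundamental triplet over $\mathbb C$. Set $\mathfrak g_{-1}=V^*$, $\mathfrak g_1=V$ and $$\Gamma(\mathfrak g_0,B_0,\rho)=\mathfrak g_{-1}\oplus\mathfrak g_0\oplus\mathfrak g_1=V^*\oplus\mathfrak g_0\oplus V .$$ Keep the Lie bracket of $\mathfrak g_0$ on $\mathfrak g_0$ and, for $U\in\mathfrak g_0$, $X\in\mathfrak g_1$, $Y\in\mathfrak g_{-1}$, define an anticommutative bracket by (a) $[U,X]=\rho(U)X$ and $[U,Y]=\rho^*(U)Y$; (b) $[X,Y]$ is the unique element of $\mathfrak g_0$ such that, for all $U\in\mathfrak g_0$, $$B_0([X,Y],U)=Y(\rho(U)X)=-(\rho^*(U)Y)(X).$$ Then this bracket defines a structure of local Lie algebra on $\Gamma(\mathfrak g_0,B_0,\rho)$.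
   Context: All vector spaces and Lie algebras are over $\mathbb C$. A quadratic Lie algebra is a pair $(\mathfrak g_0,B_0)$ where $\mathfrak g_0$ is a finite-dimensional Lie algebra and $B_0$ is a non-degenerate invariant symmetric bilinear form on $\mathfrak g_0$. A fundamental triplet $(\mathfrak g_0,B_0,(\rho,V))$ consists of a quadratic Lie algebra $(\mathfrak g_0,B_0)$ and a finite-dimensional representation $(\rho,V)$ of $\mathfrak g_0$; $(\rho^*,V^* )$ denotes the contragredient representation. A local Lie algebra is a direct sum $\Gamma=\mathfrak g_{-1}\oplus\mathfrak g_0\oplus\mathfrak g_1$ of finite-dimensional spaces with bilinear anticommutative brackets $\mathfrak g_i\times\mathfrak g_j\to\mathfrak g_{i+j}$ for $i,j\in\{-1,0,1\}$ with $|i+j|\le 1$, such that the Jacobi identity $[x,[y,z]]=[[x,y],z]+[y,[x,z]]$ holds each time its three terms are defined. *)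

(* Defs.v *)
From HB Require Import structures.
From mathcomp Require Import all_boot all_order all_algebra.
From mathcomp Require Import sesquilinear.
From mathcomp Require Import reals complex.
Set Implicit Arguments.
Unset Strict Implicit.
Unset Printing Implicit Defensive.
Import GRing.Theory.
Local Open Scope ring_scope.

HB.mixin Record hasLieBracket (K : fieldType) g of Vector K g := {
  lie_bracket : g -> g -> g;
  lie_bracket_bilinear : bilinear_for *:%R *:%R lie_bracket;
  lie_bracketxx : forall x, lie_bracket x x = 0;
  lie_jacobi : forall x y z,
    lie_bracket x (lie_bracket y z) =
    lie_bracket (lie_bracket x y) z + lie_bracket y (lie_bracket x z)
}.

(* Finite-dimensional Lie algebras over K. *)
#[short(type="lieAlgType")]
HB.structure Definition LieAlg (K : fieldType) :=
  {g of Vector K g & hasLieBracket K g}.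

Record is_quadratic (K : fieldType) (g : lieAlgType K) (B : {symmetric g}) :
  Prop := {
  quadratic_nondegenerate : nondegenerate B;
  quadratic_invariant :
    forall x y z : g, B (lie_bracket x y) z = B x (lie_bracket y z)
}.

Definition is_representation (K : fieldType) (g : lieAlgType K)
    (V : vectType K) (rho : {linear g -> 'End(V)}) : Prop :=
  forall x y : g,
    rho (lie_bracket x y) = ((rho x \o rho y) - (rho y \o rho x))%VF.

Definition is_fundamental_triplet (K : fieldType) (g0 : lieAlgType K)
    (B0 : {symmetric g0}) (V : vectType K) (rho : {linear g0 -> 'End(V)}) :
  Prop := is_quadratic B0 /\ is_representation rho.

Definition dual (K : fieldType) (V : vectType K) : vectType K := 'Hom(V, K^o).

Definition contragredient (K : fieldType) (g : lieAlgType K) (V : vectType K)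
    (rho : {linear g -> 'End(V)}) (x : g) (phi : dual V) : dual V :=
  (- (phi \o rho x))%VF.

Inductive degree := deg_m1 | deg_0 | deg_1.

Definition int_of_degree (i : degree) : int :=
  match i with deg_m1 => -1 | deg_0 => 0 | deg_1 => 1 end.
Definition deg_add (i j k : degree) : Prop :=
  int_of_degree i + int_of_degree j = int_of_degree k.

(* The direct sum g_{-1} (+) g_0 (+) g_1 is given by the family of its
   homogeneous components, since brackets are only taken between those.
   As k ranges over {-1, 0, 1}, the argument deg_add i j k expresses that
   the bracket g_i x g_j -> g_(i+j) is defined exactly when |i + j| <= 1. *)
Definition local_bracket (K : fieldType) (G : degree -> vectType K) : Type :=
  forall i j k : degree, deg_add i j k -> G i -> G j -> G k.

Definition local_anticommutative (K : fieldType) (G : degree -> vectType K)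
    (br : local_bracket G) : Prop :=
  forall (i j k : degree) (ij : deg_add i j k) (ji : deg_add j i k)
    (x : G i) (y : G j), br i j k ij x y = - br j i k ji y x.

Record is_local_lie_algebra (K : fieldType) (G : degree -> vectType K)
    (br : local_bracket G) : Prop := {
  local_linearl : forall (i j k : degree) (ij : deg_add i j k) (y : G j),
    linear (fun x : G i => br i j k ij x y);
  local_linearr : forall (i j k : degree) (ij : deg_add i j k) (x : G i),
    linear (fun y : G j => br i j k ij x y);
  local_anticomm : local_anticommutative br;
  (* The six degree hypotheses say that the three terms are defined. *)
  local_jacobi : forall (i j k ij jk ik s : degree)
    (Eij : deg_add i j ij) (Ejk : deg_add j k jk)
    (Eik : deg_add i k ik) (Ei_jk : deg_add i jk s)
    (Eij_k : deg_add ij k s) (Ej_ik : deg_add j ik s)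
    (x : G i) (y : G j) (z : G k),
    br _ _ _ Ei_jk x (br _ _ _ Ejk y z) =
    br _ _ _ Eij_k (br _ _ _ Eij x y) z +
    br _ _ _ Ej_ik y (br _ _ _ Eik x z)
}.

Definition Gamma (K : fieldType) (g0 : lieAlgType K) (V : vectType K)
    (i : degree) : vectType K :=
  match i with deg_m1 => dual V | deg_0 => g0 | deg_1 => V end.

Record is_Gamma_bracket (K : fieldType) (g0 : lieAlgType K)
    (B0 : {symmetric g0}) (V : vectType K) (rho : {linear g0 -> 'End(V)})
    (br : local_bracket (Gamma g0 V)) : Prop := {
  Gamma_anticomm : local_anticommutative br;
  Gamma_bracket00 : forall e (U U' : g0),
    br deg_0 deg_0 deg_0 e U U' = lie_bracket U U';
  Gamma_bracket01 : forall e (U : g0) (X : V),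
    br deg_0 deg_1 deg_1 e U X = rho U X;
  Gamma_bracket0m1 : forall e (U : g0) (Y : dual V),
    br deg_0 deg_m1 deg_m1 e U Y = contragredient rho U Y;
  Gamma_bracket1m1 : forall e (X : V) (Y : dual V) (U : g0),
    B0 (br deg_1 deg_m1 deg_0 e X Y) U = Y (rho U X)
}.

(* Main.v *)
From HB Require Import structures.
Require Import Defs.
From mathcomp Require Import all_boot all_order all_algebra.
From mathcomp Require Import sesquilinear.
From mathcomp Require Import boolp.
From mathcomp Require Import reals complex.
Set Implicit Arguments.
Unset Strict Implicit.
Unset Printing Implicit Defensive.
Import GRing.Theory.
Local Open Scope ring_scope.

(** Nondegeneracy of [B0] makes [Z |-> B0 Z] an injective linear map from [g0]
    to its dual; the dimensions agree, so every linear form on [g0] is [B0 Z]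
    for exactly one [Z] ([riesz], [nondegenerate_inj]).  Applied to the matrix
    coefficient [U |-> Y (rho U X)] this produces [[X, Y]], the other brackets
    are given outright, and anticommutativity fixes those in the opposite
    order; hence the bracket exists and is unique.

    For the Jacobi identity, note that anticommutativity and bilinearity carry
    the identity for three degrees to the identity for any permutation of them
    ([jacobi_at_swap12], [jacobi_at_swap23]).  The three terms are defined only
    if at most one degree is 1 and at most one is -1, which leaves, up to
    order, four cases.  Three of them say in turn that [g0] is a Lie algebra,
    that [rho] is a representation and that its contragredient is one.  The
    fourth, [[U, [X, Y]] = [[U, X], Y] + [X, [U, Y]]], is where the invariance
    of [B0] enters: paired with [W] in [g0], the left side becomes
    [Y (rho [W, U] X)] and the right side
    [Y (rho W (rho U X)) - Y (rho U (rho W X))]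
    ([Gamma_jacobi01m]). *)

(** * Nondegenerate symmetric forms *)

Section SymmetricForm.
Variables (K : fieldType) (U : vectType K) (B : {symmetric U}).

Hypothesis ndB : nondegenerate B.

Lemma nondegenerate_inj (x y : U) : (forall u, B x u = B y u) -> x = y.
Proof.
move=> eqxy; apply/eqP; rewrite -subr_eq0 -memv0 -(eqP ndB).
by apply/mem_orthovP => u _; rewrite linearBl /= eqxy subrr.
Qed.

(** A map into [U] inherits linearity from its pairings; this is how the
    bracket of degrees 1 and -1, known only through the form, is shown to be
    bilinear. *)
Lemma nondegenerate_linear (W : lmodType K) (f : W -> U) :
  (forall u, linear (fun w => B (f w) u : K^o)) -> linear f.
Proof.
move=> lin a w w'; apply: nondegenerate_inj => u.
by rewrite lin linearPl.
Qed.

Let form_linear_subproof (x : U) : linear (B x : U -> K^o).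
Proof. by move=> a u v; rewrite linearPr. Qed.

Let form_lin (x : U) : {linear U -> K^o} :=
  HB.pack (B x : U -> K^o)
    (GRing.isLinear.Build _ _ _ _ _ (form_linear_subproof x)).

Let flat_linear_subproof : linear (fun x => linfun (form_lin x)).
Proof.
move=> a x y; apply/lfunP => u.
by rewrite add_lfunE scale_lfunE !lfunE /= linearPl.
Qed.

Let flat_lin : {linear U -> 'Hom(U, K^o)} :=
  HB.pack (fun x => linfun (form_lin x))
    (GRing.isLinear.Build _ _ _ _ _ flat_linear_subproof).

(** An injective linear map between spaces of equal finite dimension is onto;
    here the map is [x |-> B x]. *)
Lemma riesz (f : 'Hom(U, K^o)) : exists x, forall u, B x u = f u.
Proof.
pose flat : 'Hom(U, 'Hom(U, K^o)) := linfun flat_lin.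
have flatE x u : flat x u = B x u by rewrite !lfunE.
have ker0 : lker flat == 0%VS.
  apply/lker0P => x y eqxy; apply: nondegenerate_inj => u.
  by rewrite -!flatE eqxy.
have : f \in limg flat.
  suff -> : limg flat = fullv by rewrite memvf.
  apply/eqP; rewrite eqEdim subvf limg_dim_eq ?(eqP ker0) ?capv0 //.
  by rewrite !dimvf /dim /= muln1.
by case/memv_imgP => x _ ->; exists x => u; rewrite flatE.
Qed.

End SymmetricForm.

HB.instance Definition _ (K : fieldType) (g : lieAlgType K) :=
  bilinear_isBilinear.Build K g g g *:%R *:%R (@lie_bracket K g)
    lie_bracket_bilinear.

(** Polarization of [lie_bracketxx] at [x + y]. *)
Lemma lie_bracketC (K : fieldType) (g : lieAlgType K) (x y : g) :
  lie_bracket x y = - lie_bracket y x.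
Proof.
apply/eqP; rewrite -addr_eq0; apply/eqP.
have := lie_bracketxx (x + y).
by rewrite linearDl /= !linearDr /= !lie_bracketxx add0r addr0.
Qed.

(** * Local brackets *)

Lemma deg_addC (i j k : degree) : deg_add i j k -> deg_add j i k.
Proof. by rewrite /deg_add addrC. Qed.

(** Fixing the three degrees makes it possible to move the Jacobi identity
    along permutations of them. *)
Definition jacobi_at (K : fieldType) (G : degree -> vectType K)
    (br : local_bracket G) (i j k : degree) : Prop :=
  forall (ij jk ik s : degree)
    (Eij : deg_add i j ij) (Ejk : deg_add j k jk)
    (Eik : deg_add i k ik) (Ei_jk : deg_add i jk s)
    (Eij_k : deg_add ij k s) (Ej_ik : deg_add j ik s)
    (x : G i) (y : G j) (z : G k),
    br _ _ _ Ei_jk x (br _ _ _ Ejk y z) =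
    br _ _ _ Eij_k (br _ _ _ Eij x y) z +
    br _ _ _ Ej_ik y (br _ _ _ Eik x z).

Section LocalBracket.
Variables (K : fieldType) (G : degree -> vectType K) (br : local_bracket G).
Hypothesis brC : local_anticommutative br.
Hypothesis br_linear : forall (i j k : degree) (ij : deg_add i j k) (y : G j),
  linear (fun x : G i => br ij x y).

Lemma local_bracket_linearr (i j k : degree) (ij : deg_add i j k) (x : G i) :
  linear (fun y : G j => br ij x y).
Proof.
by move=> a y y'; rewrite !(brC ij (deg_addC ij)) br_linear opprD scalerN.
Qed.

Lemma local_bracketNl (i j k : degree) (ij : deg_add i j k) (x : G i) (y : G j) :
  br ij (- x) y = - br ij x y.
Proof.
have br0 : br ij 0 y = 0.
  by have := br_linear ij y (-1) 0 0; rewrite scaler0 add0r scaleN1r addNr.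
by have := br_linear ij y (-1) x 0; rewrite br0 !addr0 !scaleN1r.
Qed.

Lemma local_bracketNr (i j k : degree) (ij : deg_add i j k) (x : G i) (y : G j) :
  br ij x (- y) = - br ij x y.
Proof. by rewrite !(brC ij (deg_addC ij)) local_bracketNl. Qed.

(** Exchanging the first two arguments moves the term [[[x, y], z]] to the
    other side of the identity, where anticommutativity restores its sign. *)
Lemma jacobi_at_swap12 (i j k : degree) :
  jacobi_at br i j k -> jacobi_at br j i k.
Proof.
move=> J ji ik jk s Eji Eik Ejk Ej_ik Eji_k Ei_jk y x z.
have Eij := deg_addC Eji.
rewrite (J _ _ _ _ Eij Ejk Eik Ei_jk Eji_k Ej_ik x y z) (brC Eji Eij).
by rewrite local_bracketNl addKr.
Qed.

(** Exchanging the last two arguments negates the left side and, by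
    anticommutativity, turns each term on the right into the opposite of the
    other one. *)
Lemma jacobi_at_swap23 (i j k : degree) :
  jacobi_at br i j k -> jacobi_at br i k j.
Proof.
move=> J ik kj ij s Eik Ekj Eij Ei_kj Eik_j Ek_ij x z y.
have Ejk := deg_addC Ekj; have Eij_k := deg_addC Ek_ij.
have Ej_ik := deg_addC Eik_j.
rewrite (brC Ekj Ejk) local_bracketNr.
rewrite (J _ _ _ _ Eij Ejk Eik Ei_kj Eij_k Ej_ik x y z).
by rewrite (brC Eik_j Ej_ik) (brC Ek_ij Eij_k) opprD addrC.
Qed.

(** The two transpositions generate all permutations, and every triple of
    degrees for which the terms are defined is a permutation of one of these
    four. *)
Lemma local_lie_algebra_of_sorted_jacobi :
  jacobi_at br deg_0 deg_0 deg_0 ->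
  jacobi_at br deg_0 deg_0 deg_1 ->
  jacobi_at br deg_0 deg_0 deg_m1 ->
  jacobi_at br deg_0 deg_1 deg_m1 ->
  is_local_lie_algebra br.
Proof.
move=> J000 J001 J00m J01m; split=> //; first exact: local_bracket_linearr.
have J010 := jacobi_at_swap23 J001.
have J100 := jacobi_at_swap12 J010.
have J0m0 := jacobi_at_swap23 J00m.
have Jm00 := jacobi_at_swap12 J0m0.
have J0m1 := jacobi_at_swap23 J01m.
have J10m := jacobi_at_swap12 J01m.
have J1m0 := jacobi_at_swap23 J10m.
have Jm01 := jacobi_at_swap12 J0m1.
have Jm10 := jacobi_at_swap23 Jm01.
have JT i j k : jacobi_at br i j k.
  (* The remaining triples repeat 1 or -1, so some inner bracket would land
     in degree 2 or -2. *)
  by case: i; case: j; case: k => //; move=> [] [] [].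
by move=> i j k ij jk ik s; apply: JT.
Qed.

End LocalBracket.

(** * The bracket of a fundamental triplet *)

Section Triplet.
Variables (K : fieldType) (g0 : lieAlgType K) (B0 : {symmetric g0}).
Variables (V : vectType K) (rho : {linear g0 -> 'End(V)}).

Lemma contragredientE (U : g0) (Y : dual V) (X : V) :
  contragredient rho U Y X = - Y (rho U X).
Proof. by rewrite /contragredient opp_lfunE comp_lfunE. Qed.

Hypothesis triplet : is_fundamental_triplet B0 rho.

Let ndB : nondegenerate B0 := quadratic_nondegenerate triplet.1.

Let coefficient_linear_subproof (X : V) (Y : dual V) :
  linear (fun U => Y (rho U X)).
Proof. by move=> a U U'; rewrite linearP add_lfunE scale_lfunE linearP. Qed.

Let coefficient (X : V) (Y : dual V) : {linear g0 -> K^o} :=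
  HB.pack (fun U => Y (rho U X))
    (GRing.isLinear.Build _ _ _ _ _ (coefficient_linear_subproof X Y)).

(** The element [Z] is the bracket [[X, Y]]: it represents through [B0] the
    matrix coefficient of [rho] attached to [X] and [Y]. *)
Lemma moment_exists (X : V) (Y : dual V) :
  exists Z : g0, forall U, B0 Z U = Y (rho U X).
Proof.
have [Z BZ] := riesz ndB (linfun (coefficient X Y)).
by exists Z => U; rewrite BZ lfunE.
Qed.

(** The argument [m] stands for the bracket [[X, Y]], which is obtained by a
    choice from [moment_exists] rather than by a formula.  The last clause only
    concerns degrees [i], [j], [k] with [i + j <> k]. *)
Definition Gamma_bracket_of (m : V -> dual V -> g0) :
    local_bracket (Gamma g0 V) :=
  fun i j k =>
  match i, j, k return
    deg_add i j k -> Gamma g0 V i -> Gamma g0 V j -> Gamma g0 V k with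
  | deg_0, deg_0, deg_0 => fun _ U U' => lie_bracket U U'
  | deg_0, deg_1, deg_1 => fun _ U X => rho U X
  | deg_1, deg_0, deg_1 => fun _ X U => - rho U X
  | deg_0, deg_m1, deg_m1 => fun _ U Y => contragredient rho U Y
  | deg_m1, deg_0, deg_m1 => fun _ Y U => - contragredient rho U Y
  | deg_1, deg_m1, deg_0 => fun _ X Y => m X Y
  | deg_m1, deg_1, deg_0 => fun _ Y X => - m X Y
  | _, _, _ => fun _ _ _ => 0
  end.

Lemma Gamma_bracket_exists :
  exists br : local_bracket (Gamma g0 V), is_Gamma_bracket B0 rho br.
Proof.
pose m X Y := sval (cid (moment_exists X Y)).
have mE X Y U : B0 (m X Y) U = Y (rho U X) by rewrite /m; case: cid => Z /= ->.
exists (Gamma_bracket_of m); split=> //.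
by move=> [] [] [] ij ji x y //=; rewrite ?opprK //; exact: lie_bracketC.
Qed.

(** The axioms prescribe one order of each pair of degrees, up to
    nondegeneracy in the case of [[X, Y]]; anticommutativity prescribes the
    other order. *)
Lemma Gamma_bracket_unique (br br' : local_bracket (Gamma g0 V)) :
  is_Gamma_bracket B0 rho br -> is_Gamma_bracket B0 rho br' -> br = br'.
Proof.
case=> C b00 b01 b0m b1m [C' b00' b01' b0m' b1m'].
have e1m e X Y : br deg_1 deg_m1 deg_0 e X Y = br' deg_1 deg_m1 deg_0 e X Y.
  by apply: (nondegenerate_inj ndB) => U; rewrite b1m b1m'.
suff eq_br i j k e x y : br i j k e x y = br' i j k e x y.
  by do 6!apply: functional_extensionality_dep => ?; apply: eq_br.
have e' := deg_addC e.
case: i j k e e' x y => [] [] [] //= e e' x y.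
- by rewrite (C _ _ _ e e') (C' _ _ _ e e') b0m b0m'.
- by rewrite (C _ _ _ e e') (C' _ _ _ e e') e1m.
- by rewrite b0m b0m'.
- by rewrite b00 b00'.
- by rewrite b01 b01'.
- by rewrite (C _ _ _ e e') (C' _ _ _ e e') b01 b01'.
Qed.

Section GammaBracket.
Variable br : local_bracket (Gamma g0 V).
Hypothesis brP : is_Gamma_bracket B0 rho br.

Lemma Gamma_bracket_linearl (i j k : degree) (ij : deg_add i j k)
    (y : Gamma g0 V j) : linear (fun x : Gamma g0 V i => br ij x y).
Proof.
have [C b00 b01 b0m b1m] := brP.
have rho_lin X : linear (fun U => rho U X).
  by move=> a U U'; rewrite linearP add_lfunE scale_lfunE.
have m_lin e Y : linear (fun X => br (i:=deg_1) (j:=deg_m1) (k:=deg_0) e X Y).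
  by apply: (nondegenerate_linear ndB) => U a X X'; rewrite !b1m !linearP.
have m_linr e X : linear (fun Y => br (i:=deg_1) (j:=deg_m1) (k:=deg_0) e X Y).
  apply: (nondegenerate_linear ndB) => U a Y Y'.
  by rewrite !b1m add_lfunE scale_lfunE.
have ji := deg_addC ij.
move=> a x x'; case: i j k ij ji x x' y => [] [] [] //= ij ji x x' y.
- rewrite !(C _ _ _ ij ji) !b0m; apply/lfunP => X.
  rewrite add_lfunE scale_lfunE !(opp_lfunE (contragredient _ _ _)).
  by rewrite !contragredientE add_lfunE scale_lfunE !opprK.
- by rewrite !(C _ _ _ ij ji) m_linr opprD scalerN.
- rewrite !b0m; apply/lfunP => X.
  rewrite add_lfunE scale_lfunE !contragredientE rho_lin.
  by rewrite linearP opprD scalerN.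
- by rewrite !b00 linearPl.
- by rewrite !b01 rho_lin.
- by rewrite m_lin.
- by rewrite !(C _ _ _ ij ji) !b01 linearP opprD scalerN.
Qed.

(** This is the representation identity for [rho]. *)
Lemma Gamma_jacobi001 : jacobi_at br deg_0 deg_0 deg_1.
Proof.
have [_ b00 b01 _ _] := brP.
move=> [] [] [] [] // ? ? ? ? ? ? U U' X; rewrite !b01 b00 triplet.2.
by rewrite add_lfunE opp_lfunE !comp_lfunE subrK.
Qed.

(** This is the representation identity for the contragredient: composing on
    the right reverses products, and the minus sign in [contragredient] makes
    up for it. *)
Lemma Gamma_jacobi00m : jacobi_at br deg_0 deg_0 deg_m1.
Proof.
have [_ b00 _ b0m _] := brP.
move=> [] [] [] [] // ? ? ? ? ? ? U U' Y; rewrite !b0m b00.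
apply/lfunP => X; rewrite add_lfunE !contragredientE !opprK triplet.2.
by rewrite add_lfunE opp_lfunE !comp_lfunE linearB opprB subrK.
Qed.

(** Equivariance of [(X, Y) |-> [X, Y]] under [g0]: invariance of [B0] moves
    [U] from the bracket [[U, [X, Y]]] onto the test element [W], where the
    defining property of [[X, Y]] applies. *)
Lemma Gamma_jacobi01m : jacobi_at br deg_0 deg_1 deg_m1.
Proof.
have [_ b00 b01 b0m b1m] := brP.
move=> [] [] [] [] // ? ? ? ? ? ? U X Y; rewrite b00 b01 b0m.
apply: (nondegenerate_inj ndB) => W; rewrite linearDl /= !b1m.
rewrite lie_bracketC linearNl /= (quadratic_invariant triplet.1) b1m.
rewrite contragredientE triplet.2.
by rewrite add_lfunE opp_lfunE !comp_lfunE linearB opprB.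
Qed.

Lemma Gamma_local_lie_algebra : is_local_lie_algebra br.
Proof.
have [C b00 _ _ _] := brP.
apply: local_lie_algebra_of_sorted_jacobi => //; first exact: Gamma_bracket_linearl.
- by move=> [] [] [] [] // ? ? ? ? ? ? U U' W; rewrite !b00 lie_jacobi.
- exact: Gamma_jacobi001.
- exact: Gamma_jacobi00m.
- exact: Gamma_jacobi01m.
Qed.

End GammaBracket.

End Triplet.

Theorem theorem3p1p2 (R : realType) (g0 : lieAlgType R[i])
    (B0 : {symmetric g0}) (V : vectType R[i]) (rho : {linear g0 -> 'End(V)}) :
  is_fundamental_triplet B0 rho ->
  [/\ forall (U : g0) (X : V) (Y : dual V),
        Y (rho U X) = - (contragredient rho U Y) X,
      forall (X : V) (Y : dual V),
        exists! Z : g0, forall U : g0, B0 Z U = Y (rho U X),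
      exists! br : local_bracket (Gamma g0 V), is_Gamma_bracket B0 rho br &
      forall br : local_bracket (Gamma g0 V),
        is_Gamma_bracket B0 rho br -> is_local_lie_algebra br].
Proof.
move=> triplet; split.
- by move=> U X Y; rewrite contragredientE opprK.
- move=> X Y; have [Z BZ] := moment_exists triplet X Y.
  exists Z; split=> // Z' BZ'.
  apply: (nondegenerate_inj (quadratic_nondegenerate triplet.1)) => U.
  by rewrite BZ BZ'.
- have [br brP] := Gamma_bracket_exists triplet.
  by exists br; split=> // br' /(Gamma_bracket_unique triplet brP).
- by move=> br; apply: Gamma_local_lie_algebra.
Qed.
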